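(* Let $G$ be a finite graph that is not a forest, and with at least one non-looping edge. Then the projective graph hypersurface $X_G$ is $\mathbb{L}$-rational, i.e. $[X_G]\equiv[\mathbb{P}^k] \mod (\mathbb{L})$ in $K(\mathrm{Var})$ for some $k\ge 0$.
   Context: Graphs are finite; looping edges and multiple edges are allowed, and graphs need not be connected (a looping edge counts as a cycle, so a forest has no looping edges). For a connected graph $G$ with edges $e_1,\dots,e_n$ and corresponding variables $t_1,\dots,t_n$, the graph polynomial is $\psi_G(t_1,\dots,t_n)=\sum_{T\subseteq G}\prod_{e\notin T}t_e$, where $T$ runs over the spanning trees of $G$ and $t_e$ is the variable of the edge $e$. For a general finite graph, $\psi_G$ is the product of the graph polynomials of its connected components. For a graph with $n$ edges, $X_G\subset\mathbb{P}^{n-1}$ denotes the projective hypersurface defined by the homogeneous polynomial $\psi_G$. $K(\mathrm{Var})$ is the Grothendieck ring of varieties over $\mathbb{Q}$: it is generated by isomorphism classes of quasi-projective varieties, with relations $[X]=[X\smallsetminus Y]+[Y]$ for closed embeddings $Y\subseteq X$ and product $[X]\cdot[Y]=[X\times Y]$. $(\mathbb{L})$ is the ideal generated by $\mathbb{L}=[\mathbb{A}^1]$. Two quasi-projective varieties $X,Y$ are $\mathbb{L}$-equivalent if $[X]\equiv[Y]\mod(\mathbb{L})$ in $K(\mathrm{Var})$. A variety is $\mathbb{L}$-rational if it is $\mathbb{L}$-equivalent to $\mathbb{P}^k$ for some $k\ge 0$. *)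

(* Defs.v *)
From HB Require Import structures.
From mathcomp Require Import all_boot all_order all_algebra all_field.
From mathcomp Require Import boolp.
From mathcomp Require Import mpoly.
From mathcomp Require monalg.

Set Implicit Arguments.
Unset Strict Implicit.
Unset Printing Implicit Defensive.

Import GRing.Theory.
Local Open Scope ring_scope.

(* Quasi-projective varieties over [rat], in classical language: a variety is a
   locally closed subset of P^(n-1) over [algC], cut out by homogeneous
   polynomials with rational coefficients, and a morphism is a map of points that
   is Zariski-locally given by homogeneous polynomials with rational
   coefficients.  As [rat] is perfect, this is the category of reduced
   quasi-projective schemes over [rat], which is all that the Grothendieck ring
   sees.  Varieties may be reducible or empty. *)

(* [n] counts homogeneous coordinates: [qproj n] lives in P^(n-1), and
   [qproj 0] in the empty space.  The pair (F, G) stands for V(F) \ V(G). *)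
Definition qproj_data n : Type := (seq {mpoly rat[n]} * seq {mpoly rat[n]})%type.

HB.instance Definition _ n := Choice.on (qproj_data n).

Definition homog_data n (D : qproj_data n) : bool :=
  all (fun p => p \is homog mdeg) D.1 && all (fun p => p \is homog mdeg) D.2.

Definition qproj n := {D : qproj_data n | homog_data D}.

HB.instance Definition _ n := Choice.on (qproj n).

Definition eqns n (X : qproj n) : seq {mpoly rat[n]} := (val X).1.
Definition neqns n (X : qproj n) : seq {mpoly rat[n]} := (val X).2.

Definition evalQ n (x : 'rV[algC]_n) (p : {mpoly rat[n]}) : algC :=
  mmap ratr (x 0) p.

(* A point of projective space is represented by any of its nonzero vectors of
   homogeneous coordinates; see [same_pt]. *)
Definition on_var n (X : qproj n) (x : 'rV[algC]_n) : bool :=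
  [&& x != 0, all (fun p => evalQ x p == 0) (eqns X)
    & has (fun p => evalQ x p != 0) (neqns X)].

Definition same_pt n (x y : 'rV[algC]_n) : Prop :=
  exists2 c : algC, c != 0 & y = c *: x.

Definition evalQs m n (h : 'I_n -> {mpoly rat[m]}) (x : 'rV[algC]_m) :
  'rV[algC]_n := \row_i evalQ x (h i).

Definition regular_map m n (X : qproj m) (Y : qproj n)
    (f : 'rV[algC]_m -> 'rV[algC]_n) : Prop :=
  (forall x, on_var X x -> on_var Y (f x)) /\
  (forall x, on_var X x ->
     exists d, exists2 h : 'I_n -> {mpoly rat[m]},
       (forall i, h i \is d.-homog) &
       evalQs h x != 0 /\
       forall y, on_var X y -> evalQs h y != 0 -> same_pt (f y) (evalQs h y)).

Definition isomorphic m n (X : qproj m) (Y : qproj n) : Prop :=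
  exists f g, [/\ regular_map X Y f, regular_map Y X g,
    forall x, on_var X x -> same_pt x (g (f x)) &
    forall y, on_var Y y -> same_pt y (f (g y))].

Definition closed_in n (Y X : qproj n) : Prop :=
  exists2 H : seq {mpoly rat[n]}, all (fun p => p \is homog mdeg) H &
    forall x, on_var Y x = on_var X x && all (fun p => evalQ x p == 0) H.

Definition complement_in n (U Y X : qproj n) : Prop :=
  forall x, on_var U x = on_var X x && ~~ on_var Y x.

Lemma homog1 n : (1 : {mpoly rat[n]}) \is homog mdeg.
Proof. exact: homogE (dhomog1 _ _). Qed.

Lemma homogXU n (i : 'I_n) : ('X_i : {mpoly rat[n]}) \is homog mdeg.
Proof. by apply: (@homogE _ _ _ 1%N); rewrite dhomogX /= mdeg1. Qed.

Fact hypersurface_homog n (p : {mpoly rat[n]}) (hp : p \is homog mdeg) :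
  homog_data ([:: p], [:: 1]).
Proof. by rewrite /homog_data /= hp homog1. Qed.

Definition hypersurface n (p : {mpoly rat[n]}) (hp : p \is homog mdeg) :
  qproj n := Sub ([:: p], [:: 1]) (hypersurface_homog hp).

Fact proj_space_homog k :
  homog_data ([::] : seq {mpoly rat[k.+1]}, [:: 1] : seq {mpoly rat[k.+1]}).
Proof. by rewrite /homog_data /= homog1. Qed.

Definition proj_space k : qproj k.+1 := Sub ([::], [:: 1]) (proj_space_homog k).

Fact affine_line_homog :
  homog_data ([::] : seq {mpoly rat[2]}, [:: 'X_ord0] : seq {mpoly rat[2]}).
Proof. by rewrite /homog_data /= homogXU. Qed.

(* A^1 as the complement of a point in P^1 *)
Definition affine_line : qproj 2 := Sub ([::], [:: 'X_ord0]) affine_line_homog.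

(* X * Y as the subvariety of P^(mn-1) of matrices of rank one whose columns lie
   in X and rows in Y; [segreP] identifies it with the image of X * Y under the
   Segre embedding. *)
Section Segre.
Variables m n : nat.

Definition segre_coord (i : 'I_m) (j : 'I_n) : {mpoly rat[m * n]} :=
  'X_(mxvec_index i j).

Definition segre_col (j : 'I_n) (p : {mpoly rat[m]}) : {mpoly rat[m * n]} :=
  p \mPo [tuple segre_coord i j | i < m].

Definition segre_row (i : 'I_m) (p : {mpoly rat[n]}) : {mpoly rat[m * n]} :=
  p \mPo [tuple segre_coord i j | j < n].

Definition segre_minors : seq {mpoly rat[m * n]} :=
  [seq segre_coord a.1 b.1 * segre_coord a.2 b.2 -
       segre_coord a.1 b.2 * segre_coord a.2 b.1
     | a <- enum {: 'I_m * 'I_m}, b <- enum {: 'I_n * 'I_n}].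

Definition segre_data (X : qproj m) (Y : qproj n) : qproj_data (m * n) :=
  (segre_minors
     ++ [seq segre_col j p | j <- enum 'I_n, p <- eqns X]
     ++ [seq segre_row i p | i <- enum 'I_m, p <- eqns Y],
   [seq p * q | p <- [seq segre_col j p | j <- enum 'I_n, p <- neqns X],
                q <- [seq segre_row i p | i <- enum 'I_m, p <- neqns Y]]).

Lemma homog_subst k l (t : k.-tuple {mpoly rat[l]}) (p : {mpoly rat[k]}) :
  (forall i, tnth t i \is 1.-homog) -> p \is homog mdeg ->
  p \mPo t \is homog mdeg.
Proof.
move=> ht /homogP[d /dhomogP hp]; apply: (@homogE _ _ _ d).
rewrite comp_mpolyEX big_seq; apply: rpred_sum => u hu.
have <- : (\sum_i u i)%N = d by rewrite -mdegE; apply: hp.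
apply: rpredZ; rewrite comp_mpolyX.
elim/big_rec2: _ => [|i d' q _ hq]; first exact: dhomog1.
by apply: dhomogM => //; rewrite -[X in X.-homog]mul1n; apply: dhomogMn.
Qed.

Lemma segre_coord_homog i j : segre_coord i j \is 1.-homog.
Proof. by rewrite dhomogX /= mdeg1. Qed.

Lemma segre_col_homog j p : p \is homog mdeg -> segre_col j p \is homog mdeg.
Proof.
by apply: homog_subst => i; rewrite tnth_mktuple segre_coord_homog.
Qed.

Lemma segre_row_homog i p : p \is homog mdeg -> segre_row i p \is homog mdeg.
Proof.
by apply: homog_subst => j; rewrite tnth_mktuple segre_coord_homog.
Qed.

Fact segre_homog X Y : homog_data (segre_data X Y).
Proof.
have /andP[/allP hX /allP hX'] := valP X; have /andP[/allP hY /allP hY'] := valP Y.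
apply/andP; split; apply/allP => p; rewrite ?mem_cat.
  case/or3P=> /allpairsPdep[a [b [_ hb ->]]].
  - apply: (@homogE _ _ _ (1 + 1)%N).
    by apply: rpredB; apply: dhomogM; apply: segre_coord_homog.
  - exact/segre_col_homog/hX.
  - exact/segre_row_homog/hY.
case/allpairsPdep => a [b [/allpairsPdep[j [q [_ hq ->]]] ]].
case/allpairsPdep => [i [r [_ hr ->]]] ->.
have /homogP[d hd] := segre_col_homog j (hX' _ hq).
have /homogP[e he] := segre_row_homog i (hY' _ hr).
exact: homogE (dhomogM hd he).
Qed.

Definition segre (X : qproj m) (Y : qproj n) : qproj (m * n) :=
  Sub (segre_data X Y) (segre_homog X Y).

End Segre.

Lemma evalQM n (x : 'rV[algC]_n) p q : evalQ x (p * q) = evalQ x p * evalQ x q.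
Proof. exact: rmorphM. Qed.

Lemma evalQB n (x : 'rV[algC]_n) p q : evalQ x (p - q) = evalQ x p - evalQ x q.
Proof. exact: rmorphB. Qed.

Lemma evalQ_coord m n (z : 'rV[algC]_(m * n)) i j :
  evalQ z (segre_coord i j) = vec_mx z i j.
Proof. by rewrite /evalQ mmapX mmap1U mxE. Qed.

Lemma evalQ_subst k l (t : k.-tuple {mpoly rat[l]}) (z : 'rV[algC]_l) p :
  evalQ z (p \mPo t) = evalQ (\row_i evalQ z (tnth t i)) p.
Proof.
rewrite /evalQ comp_mpolyEX raddf_sum [RHS]/mmap; apply: eq_bigr => u _ /=.
rewrite mmapZ /=; congr (_ * _).
rewrite comp_mpolyX rmorph_prod /mmap1; apply: eq_bigr => i _ /=.
by rewrite rmorphXn mxE.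
Qed.

Lemma evalQ_col m n (z : 'rV[algC]_(m * n)) j p :
  evalQ z (segre_col j p) = evalQ (col j (vec_mx z))^T p.
Proof.
rewrite evalQ_subst; congr evalQ.
by apply/rowP => i; rewrite !mxE tnth_mktuple evalQ_coord mxE.
Qed.

Lemma evalQ_row m n (z : 'rV[algC]_(m * n)) i p :
  evalQ z (segre_row i p) = evalQ (row i (vec_mx z)) p.
Proof.
rewrite evalQ_subst; congr evalQ.
by apply/rowP => j; rewrite !mxE tnth_mktuple evalQ_coord mxE.
Qed.

Lemma evalQ_homog n d (p : {mpoly rat[n]}) c x :
  p \is d.-homog -> evalQ (c *: x) p = c ^+ d * evalQ x p.
Proof.
move=> /dhomogP hp; rewrite /evalQ /mmap mulr_sumr.
apply: eq_big_seq => u hu; rewrite mulrCA; congr (_ * _).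
have <- : (\sum_i u i)%N = d by rewrite -mdegE; apply: hp.
rewrite /mmap1 -prodrXr -big_split /=; apply: eq_bigr => i _.
by rewrite mxE exprMn.
Qed.

Lemma evalQ_eq0Z n (p : {mpoly rat[n]}) c x :
  p \is homog mdeg -> c != 0 -> (evalQ (c *: x) p == 0) = (evalQ x p == 0).
Proof.
move=> /homogP[d hp] c0; rewrite (evalQ_homog _ _ hp) mulf_eq0.
by rewrite expf_eq0 (negPf c0) andbF.
Qed.

Lemma on_varZ n (X : qproj n) c x :
  c != 0 -> on_var X (c *: x) = on_var X x.
Proof.
move=> c0; have /andP[/allP h1 /allP h2] := valP X.
rewrite /on_var scaler_eq0 (negPf c0) /=; congr [&& _, _ & _].
  by apply: eq_in_all => p /h1 hp; rewrite evalQ_eq0Z.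
by apply: eq_in_has => p /h2 hp; rewrite evalQ_eq0Z.
Qed.

Lemma segreP m n (X : qproj m) (Y : qproj n) (z : 'rV[algC]_(m * n)) :
  on_var (segre X Y) z <->
  exists x y, [/\ on_var X x, on_var Y y & z = mxvec (x^T *m y)].
Proof.
have /andP[/allP hX /allP hX'] := valP X; have /andP[/allP hY /allP hY'] := valP Y.
split.
  case/and3P => z0; rewrite /= !all_cat => /and3P[/allP hm /allP hc /allP hr'].
  case/hasP => _ /allpairsPdep[_ [_ [/allpairsPdep[j [p [_ hp ->]]]
    /allpairsPdep[i [q [_ hq ->]]] ->]]].
  rewrite evalQM mulf_eq0 negb_or evalQ_col evalQ_row => /andP[pz qz].
  have [M zM] : {M | vec_mx z = M} by exists (vec_mx z).
  rewrite zM in pz qz.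
  have minor a b c d : M a b * M c d = M a d * M c b.
    have /hm : segre_coord (a, c).1 (b, d).1 * segre_coord (a, c).2 (b, d).2 -
      segre_coord (a, c).1 (b, d).2 * segre_coord (a, c).2 (b, d).1
      \in segre_minors m n.
      by apply: (allpairs_f (fun (a : 'I_m * 'I_m) (b : 'I_n * 'I_n) =>
        segre_coord a.1 b.1 * segre_coord a.2 b.2 -
        segre_coord a.1 b.2 * segre_coord a.2 b.1)); rewrite mem_enum.
    rewrite evalQB !evalQM !evalQ_coord zM.
    by rewrite subr_eq0 => /eqP.
  have [[a b] /= Mab] : exists ab : 'I_m * 'I_n, M ab.1 ab.2 != 0.
    apply/existsP; apply: contraNT z0 => /existsPn h.
    rewrite -[z]vec_mxK zM; have -> : M = 0; last by rewrite linear0.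
    apply/matrixP => a b; rewrite [RHS]mxE; apply/eqP.
    by have := h (a, b); rewrite negbK.
  have Mab' : (M a b)^-1 != 0 by rewrite invr_eq0.
  have nz_sub c k e (r : {mpoly rat[k]}) (x y : 'rV_k) : r \is e.-homog ->
      x = c *: y -> evalQ x r != 0 -> evalQ y r != 0.
    by move=> he ->; rewrite (evalQ_homog _ _ he) mulf_eq0 negb_or => /andP[].
  have Xcol : on_var X (col b M)^T.
    apply/and3P; split.
    - by apply: contraNneq Mab => /rowP/(_ a); rewrite !mxE => ->.
    - apply/allP => r hr; rewrite -zM -evalQ_col; apply: hc.
      by apply: allpairs_f; rewrite ?mem_enum.
    - apply/hasP; exists p => //; have /homogP[e he] := hX' _ hp.
      apply: (nz_sub (M a j / M a b) _ _ _ _ _ he _ pz).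
      by apply/rowP => k; rewrite !mxE mulrAC minor mulrC mulKf.
  have Yrow : on_var Y (row a M).
    apply/and3P; split.
    - by apply: contraNneq Mab => /rowP/(_ b); rewrite !mxE => ->.
    - apply/allP => r hr; rewrite -zM -evalQ_row; apply: hr'.
      by apply: allpairs_f; rewrite ?mem_enum.
    - apply/hasP; exists q => //; have /homogP[e he] := hY' _ hq.
      apply: (nz_sub (M i b / M a b) _ _ _ _ _ he _ qz).
      by apply/rowP => k; rewrite !mxE mulrAC minor mulfK.
  exists ((M a b)^-1 *: (col b M)^T), (row a M); split=> //; first by rewrite on_varZ.
  rewrite -[LHS]vec_mxK zM; congr mxvec; apply/matrixP => k l.
  by rewrite !mxE big_ord1 !mxE -mulrA minor mulrC mulfK.
case=> x [y [/and3P[x0 /allP x1 /hasP[p hp px]] /and3P[y0 /allP y1 /hasP[q hq qy]]]].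
move=> zE; have zM : vec_mx z = x^T *m y by rewrite zE mxvecK.
have colz j : (col j (vec_mx z))^T = y 0 j *: x.
  by apply/rowP => i; rewrite zM !mxE big_ord1 mxE mulrC.
have rowz i : row i (vec_mx z) = x 0 i *: y.
  by apply/rowP => j; rewrite zM !mxE big_ord1 mxE.
have nz k (v : 'rV[algC]_k) : v != 0 -> exists i, v 0 i != 0.
  move=> v0; apply/existsP; apply: contraNT v0 => /existsPn h.
  apply/eqP/rowP => l; rewrite [RHS]mxE; apply/eqP.
  by have := h l; rewrite negbK.
have [i xi] := nz _ _ x0; have [j yj] := nz _ _ y0.
apply/and3P; split.
- apply/eqP => zz; have : vec_mx z i j = 0 by rewrite zz linear0 mxE.
  by rewrite zM !mxE big_ord1 mxE; apply/eqP/mulf_neq0.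
- rewrite /= !all_cat; apply/and3P; split; apply/allP => _ /allpairsPdep[a [b [_ hb ->]]].
  + rewrite evalQB !evalQM !evalQ_coord zM !mxE !big_ord1 !mxE.
    by rewrite subr_eq0; apply/eqP; rewrite mulrACA [y 0 _ * _]mulrC mulrACA.
  + have /homogP[d hd] := hX _ hb.
    by rewrite evalQ_col colz (evalQ_homog _ _ hd) (eqP (x1 _ hb)) mulr0.
  + have /homogP[d hd] := hY _ hb.
    by rewrite evalQ_row rowz (evalQ_homog _ _ hd) (eqP (y1 _ hb)) mulr0.
- apply/hasP; exists (segre_col j p * segre_row i q).
    by apply: allpairs_f; apply: allpairs_f; rewrite ?mem_enum.
  rewrite evalQM evalQ_col evalQ_row colz rowz mulf_neq0 //.
    by rewrite evalQ_eq0Z // hX'.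
  by rewrite evalQ_eq0Z // hY'.
Qed.

Definition qpvar := {n : nat & qproj n}.

HB.instance Definition _ := Choice.on qpvar.

Section FreeRing.
Import monalg.

(* the free commutative ring on the set of all varieties *)
Definition var_ring := {malg int[{cmonom qpvar}]}.

HB.instance Definition _ := GRing.ComNzRing.on var_ring.

Definition var_gen n (X : qproj n) : var_ring := << ucm (Tagged qproj X) >>.

End FreeRing.

(* [kvar_rel_unit]: the class of a point, which is neutral for the
   product of varieties, is the unit of the presented ring. *)
Inductive kvar_rel : var_ring -> Prop :=
| kvar_rel_iso m n (X : qproj m) (Y : qproj n) :
    isomorphic X Y -> kvar_rel (var_gen X - var_gen Y)
| kvar_rel_scissors n (X Y U : qproj n) :
    closed_in Y X -> complement_in U Y X ->
    kvar_rel (var_gen X - (var_gen U + var_gen Y))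
| kvar_rel_prod m n (X : qproj m) (Y : qproj n) :
    kvar_rel (var_gen X * var_gen Y - var_gen (segre X Y))
| kvar_rel_unit : kvar_rel (var_gen (proj_space 0) - 1).

Definition in_kvar_ideal (x : var_ring) : Prop :=
  exists2 s : seq (var_ring * var_ring),
    (forall p, p \in s -> kvar_rel p.2) & x = \sum_(p <- s) p.1 * p.2.

Definition kvar_ideal : {pred var_ring} := fun x => `[< in_kvar_ideal x >].

Lemma kvar_idealP x : reflect (in_kvar_ideal x) (x \in kvar_ideal).
Proof. exact: asboolP. Qed.

Lemma kvar_idealMl a x : x \in kvar_ideal -> a * x \in kvar_ideal.
Proof.
move=> /kvar_idealP[s hs ->]; apply/kvar_idealP.
exists [seq (a * p.1, p.2) | p <- s]; first by move=> _ /mapP[q /hs hq ->].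
by rewrite big_map mulr_sumr; apply: eq_bigr => p _; rewrite mulrA.
Qed.

Fact kvar_ideal_zmod_closed : zmod_closed kvar_ideal.
Proof.
split=> [|x y hx /(kvar_idealMl (-1))]; rewrite ?mulN1r.
  by apply/kvar_idealP; exists [::]; rewrite ?big_nil.
move: hx => /kvar_idealP[s hs ->] /kvar_idealP[t ht ->]; apply/kvar_idealP.
exists (s ++ t); last by rewrite big_cat.
by move=> p; rewrite mem_cat => /orP[/hs | /ht].
Qed.

HB.instance Definition _ :=
  GRing.isZmodClosed.Build var_ring kvar_ideal kvar_ideal_zmod_closed.

(* K(Var).  The quotient construction of [ring_quotient] gives the additive
   group; its multiplication is not available there without a proof that
   K(Var) is nontrivial, hence is defined here. *)
Definition KVar := Quotient.quot kvar_ideal.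

HB.instance Definition _ := GRing.Zmodule.on KVar.
HB.instance Definition _ := EqQuotient.on KVar.

Definition kvar_pi (x : var_ring) : KVar := \pi_KVar%qT x.

Lemma kvar_pi_eq x y : kvar_pi x = kvar_pi y <-> x - y \in kvar_ideal.
Proof.
rewrite (Quotient.idealrBE kvar_ideal x y).
by split=> [h|/eqP h]; [apply/eqP|]; exact: h.
Qed.

Lemma kvar_piB : {morph kvar_pi : x y / x - y}.
Proof. exact: raddfB. Qed.

Lemma kvar_piD : {morph kvar_pi : x y / x + y}.
Proof. exact: raddfD. Qed.

Lemma kvar_piK (x : KVar) : kvar_pi (repr x) = x.
Proof. exact: reprK. Qed.

Definition kvar_one : KVar := kvar_pi 1.
Definition kvar_mul (x y : KVar) : KVar := kvar_pi (repr x * repr y).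

Lemma kvar_mul_pi x y : kvar_mul (kvar_pi x) (kvar_pi y) = kvar_pi (x * y).
Proof.
apply/kvar_pi_eq; set x' := repr _; set y' := repr _.
have hx : x' - x \in kvar_ideal by apply/kvar_pi_eq; rewrite kvar_piK.
have hy : y' - y \in kvar_ideal by apply/kvar_pi_eq; rewrite kvar_piK.
have -> : x' * y' - x * y = y' * (x' - x) + x * (y' - y).
  by rewrite !mulrBr ![y' * _]mulrC addrA subrK.
by apply: rpredD; apply: kvar_idealMl.
Qed.

Lemma kvar_mulA : associative kvar_mul.
Proof.
move=> x y z; rewrite -(kvar_piK x) -(kvar_piK y) -(kvar_piK z).
by rewrite !kvar_mul_pi mulrA.
Qed.

Lemma kvar_mulC : commutative kvar_mul.
Proof. by move=> x y; rewrite /kvar_mul mulrC. Qed.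

Lemma kvar_mul1 : left_id kvar_one kvar_mul.
Proof. by move=> x; rewrite -(kvar_piK x) kvar_mul_pi mul1r. Qed.

Lemma kvar_mulDl : left_distributive kvar_mul +%R.
Proof.
move=> x y z; rewrite -(kvar_piK x) -(kvar_piK y) -(kvar_piK z).
by rewrite -kvar_piD !kvar_mul_pi mulrDl kvar_piD.
Qed.

HB.instance Definition _ := GRing.Zmodule_isComPzRing.Build KVar
  kvar_mulA kvar_mulC kvar_mul1 kvar_mulDl.

Definition kclass n (X : qproj n) : KVar := kvar_pi (var_gen X).

Lemma kvar_rel0 x : kvar_rel x -> kvar_pi x = 0.
Proof.
move=> hx; have /kvar_pi_eq -> : x - 0 \in kvar_ideal; last first.
  by rewrite -(subrr 0) kvar_piB subrr.
rewrite subr0; apply/kvar_idealP; exists [:: (1, x)]; last by rewrite big_seq1 mul1r.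
by move=> p; rewrite inE => /eqP->.
Qed.

Lemma kclass_iso m n (X : qproj m) (Y : qproj n) :
  isomorphic X Y -> kclass X = kclass Y.
Proof. by move=> /kvar_rel_iso/kvar_rel0; rewrite kvar_piB => /subr0_eq. Qed.

Lemma kclass_scissors n (X Y U : qproj n) :
  closed_in Y X -> complement_in U Y X -> kclass X = kclass U + kclass Y.
Proof.
move=> hY hU; have := kvar_rel0 (kvar_rel_scissors hY hU).
by rewrite kvar_piB kvar_piD => /subr0_eq.
Qed.

Lemma kclass_prod m n (X : qproj m) (Y : qproj n) :
  kclass X * kclass Y = kclass (segre X Y).
Proof.
have := kvar_rel0 (kvar_rel_prod X Y).
by rewrite kvar_piB -kvar_mul_pi => /subr0_eq.
Qed.

Lemma kclass_point : kclass (proj_space 0) = 1.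
Proof. by have := kvar_rel0 kvar_rel_unit; rewrite kvar_piB => /subr0_eq. Qed.

Definition Lclass : KVar := kclass affine_line.

Definition L_equivalent m n (X : qproj m) (Y : qproj n) : Prop :=
  exists a : KVar, kclass X - kclass Y = a * Lclass.

Definition L_rational n (X : qproj n) : Prop :=
  exists k, L_equivalent X (proj_space k).

(* Finite multigraphs; the order of the two ends of an edge is irrelevant. *)
Record mgraph := MGraph {
  vert : finType;
  edge : finType;
  ends : edge -> vert * vert
}.

Section Graph.
Variable G : mgraph.
Implicit Types (T : {set edge G}) (C : {set vert G}).

Definition looping_edge (e : edge G) : bool := (ends e).1 == (ends e).2.

Definition adj T : rel (vert G) := fun u v =>
  [exists e in T, (ends e == (u, v)) || (ends e == (v, u))].

(* an edge with a direction of travel *)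
Definition dart : Type := (edge G * bool)%type.
Definition dsrc (d : dart) : vert G := if d.2 then (ends d.1).2 else (ends d.1).1.
Definition dtgt (d : dart) : vert G := if d.2 then (ends d.1).1 else (ends d.1).2.

Definition is_cycle T (c : seq dart) : bool :=
  [&& c != [::], all (fun d => d.1 \in T) c,
      cycle (fun d d' => dtgt d == dsrc d') c,
      uniq [seq d.1 | d <- c] & uniq [seq dsrc d | d <- c]].

Definition acyclic T : Prop := forall c, ~~ is_cycle T c.

Definition forest : Prop := acyclic [set: edge G].

Definition components : {set {set vert G}} :=
  equivalence_partition (connect (adj [set: edge G])) [set: vert G].

Definition edges_in C : {set edge G} :=
  [set e | ((ends e).1 \in C) && ((ends e).2 \in C)].

(* [T] is the edge set of a spanning tree of the subgraph induced on [C] *)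
Definition spanning_tree C T : bool :=
  [&& T \subset edges_in C,
      [forall u in C, forall v in C, connect (adj T) u v] & `[< acyclic T >]].

(* the graph polynomial of the subgraph induced on [C] *)
Definition component_poly C : {mpoly rat[#|edge G|]} :=
  \sum_(T : {set edge G} | spanning_tree C T)
     \prod_(e in edges_in C :\: T) 'X_(enum_rank e).

Definition graph_poly : {mpoly rat[#|edge G|]} :=
  \prod_(C in components) component_poly C.

Lemma adjC T : ssrbool.symmetric (adj T).
Proof. by move=> u v; apply: eq_existsb => e; rewrite orbC. Qed.

Lemma connect_adjC T : connect_sym (adj T).
Proof. by apply: sym_connect_sym => u v; rewrite adjC. Qed.

Lemma adj_dart T u v :
  adj T u v -> exists d : dart, [/\ d.1 \in T, dsrc d = u & dtgt d = v].
Proof.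
case/existsP => e /andP[eT /orP[]/eqP he].
  by exists (e, false); rewrite /dsrc /dtgt /= he.
by exists (e, true); rewrite /dsrc /dtgt /= he.
Qed.

Lemma path_darts T u p (d0 : dart) : path (adj T) u p -> uniq (u :: p) ->
  dtgt d0 = u ->
  exists c : seq dart,
    [/\ all (fun d => d.1 \in T) c, map dsrc c = belast u p, map dtgt c = p,
        uniq (map fst c) & path (fun d d' => dtgt d == dsrc d') d0 c].
Proof.
elim: p u d0 => [|v p IH] u d0; first by exists [::].
rewrite [path _ _ _]/= => /andP[/adj_dart[d [dT du dv]] pv].
rewrite cons_uniq => /andP[uvp uv] d0u.
have [c [cT cs ct cu cp]] := IH v d pv uv dv.
exists (d :: c); split; rewrite /= ?dT ?cs ?ct ?du ?dv ?d0u ?eqxx //.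
rewrite cu andbT; apply: contra uvp => /mapP[d' d'c dd'].
have hs : dsrc d' \in v :: p.
  by rewrite mem_belast // -cs map_f.
have ht : dtgt d' \in v :: p by rewrite inE -ct map_f ?orbT.
have : (u == dsrc d') || (u == dtgt d').
  rewrite -du /dsrc /dtgt -dd'.
  by case: (d.2); case: (d'.2); rewrite eqxx ?orbT.
by case/orP => /eqP->.
Qed.

Lemma cycle_of_edge T e :
  e \in T -> connect (adj (T :\ e)) (ends e).2 (ends e).1 -> ~ acyclic T.
Proof.
move=> eT /connectP[p0 /shortenP[p pp pu _] lp].
have [//|c [cT cs ct cu cp]] := @path_darts _ _ _ (e, false) pp pu.
move/(_ ((e, false) :: c))/negP; apply.
have cT' : all (fun d => d.1 \in T) c.
  by apply: sub_all cT => d; rewrite inE => /andP[].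
have ec : e \notin map fst c.
  by apply/mapP => -[d /(allP cT)]; rewrite !inE => /andP[/eqP ? _] /esym.
apply/and5P; split=> //=; first by rewrite eT.
- rewrite rcons_path cp /=; apply/eqP; rewrite -(last_map dtgt) ct.
  exact: esym lp.
- by rewrite ec.
- rewrite cs; have -> : dsrc (e, false) = last (ends e).2 p by [].
  by rewrite -rcons_uniq -lastI.
Qed.

Lemma rooted_parents C T r : r \in C ->
  {in C, forall v, connect (adj T) r v} ->
  T \subset edges_in C ->
  exists (par : vert G -> vert G) (ht : vert G -> nat),
    {in C, forall v, v != r ->
       [/\ par v \in C, adj T v (par v) & (ht (par v) < ht v)%N]}.
Proof.
move=> rC conn TC.
pose P v k := exists p : seq (vert G), [/\ path (adj T) r p, last r p = v & size p = k].
have inC p : path (adj T) r p -> last r p \in C.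
  elim/last_ind: p => // p v _; rewrite rcons_path last_rcons => /andP[_].
  case/existsP => e /andP[/(subsetP TC)]; rewrite inE => /andP[e1 e2].
  by case/orP => /eqP he; rewrite he in e1 e2.
have /choice[ht htP] : forall v, exists n : nat,
    v \in C -> P v n /\ forall k, P v k -> (n <= k)%N.
  move=> v.
  have [vC|] := boolP (v \in C); last by exists 0%N.
  have ex : exists k, `[< P v k >].
    case/connectP: (conn _ vC) => p pp ->.
    by exists (size p); apply/asboolP; exists p.
  case: (ex_minnP ex) => k /asboolP Pk mink.
  by exists k => _; split=> // l Pl; apply: mink; apply/asboolP.
have : forall v, exists w, v \in C -> v != r ->
    [/\ w \in C, adj T v w & (ht w < ht v)%N].
  move=> v; have [vC|] := boolP (v \in C); last by exists v.
  have [[p [pp lp sp]] _] := htP v vC.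
  case/lastP: p pp lp sp => [|p w] pp; rewrite ?last_rcons => lp sp.
    by exists v => _; rewrite -lp eqxx.
  move: pp; rewrite rcons_path lp => /andP[pp av].
  exists (last r p) => _ _; split; rewrite ?inC // 1?adjC //.
  rewrite -sp size_rcons ltnS; apply: (htP _ (inC _ pp)).2.
  by exists p.
by case/choice => par parP; exists par, ht => v vC vr; apply: parP.
Qed.

Lemma spanning_tree_card C T : spanning_tree C T -> #|T| = #|C|.-1.
Proof.
case/and3P => TC /forall_inP conn /asboolP acT.
have [C0|[r rC]] := set_0Vmem C.
  rewrite C0 cards0; apply/eqP; rewrite cards_eq0 -subset0; apply/subsetP => e.
  by move/(subsetP TC); rewrite C0 !inE.
have connr v : v \in C -> connect (adj T) r v by apply/forall_inP/conn.
have [par [ht parP]] := rooted_parents rC connr TC.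
have : forall v, exists o : option (edge G), v \in C -> v != r ->
    exists2 e, o = Some e &
      e \in T /\ (ends e = (v, par v) \/ ends e = (par v, v)).
  move=> v; have [/andP[vC vr]|] := boolP ((v \in C) && (v != r)).
    have [_ /existsP[e /andP[eT /orP h]] _] := parP v vC vr.
    exists (Some e) => _ _; exists e => //; split=> //.
    by case: h => /eqP; [left|right].
  by move=> h; exists None => vC vr; rewrite vC vr in h.
case/choice => pe peP.
rewrite -(card_imset T (@Some_inj _)) (cardsD1 r C) rC /=.
have -> : [set Some e | e in T] = [set pe v | v in C :\ r].
  apply/setP => o; apply/imsetP/imsetP => [[e eT ->]|[v]]; last first.
    rewrite !inE => /andP[vr vC] ->.
    by have [e -> [eT _]] := peP v vC vr; exists e.
  have [/existsP[v /and3P[vC vr /eqP pv]]|no] :=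
    boolP [exists v, [&& v \in C, v != r & pe v == Some e]].
    by exists v; rewrite ?inE ?vC ?vr.
  have toroot v : v \in C -> connect (adj (T :\ e)) v r.
    have [k] := ubnP (ht v); elim: k v => // k IH v hk vC.
    have [->|vr] := eqVneq v r; first exact: connect0.
    have [wC _ lt] := parP v vC vr.
    apply: connect_trans (IH _ (leq_trans lt hk) wC); apply: connect1.
    have [f pf [fT hf]] := peP v vC vr.
    apply/existsP; exists f; rewrite !inE fT andbT; apply/andP; split.
      apply: contraNneq no => fe; apply/existsP; exists v.
      by rewrite vC vr pf fe eqxx.
    by case: hf => ->; rewrite eqxx ?orbT.
  case: (cycle_of_edge eT _ acT).
  have := subsetP TC _ eT; rewrite inE => /andP[e1 e2].
  apply: connect_trans (toroot _ e2) _.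
  by rewrite connect_adjC toroot.
apply: card_in_imset => v w; rewrite !inE => /andP[vr vC] /andP[wr wC] vw.
have [e pv [_ hv]] := peP v vC vr; have [f pw [_ hw]] := peP w wC wr.
have [_ _ ltv] := parP v vC vr; have [_ _ ltw] := parP w wC wr.
move: pv pw; rewrite vw => -> [ef]; rewrite -ef in hw.
have absurd : par v = w -> v = par w -> v = w.
  by move=> p q; rewrite p in ltv; rewrite -q in ltw;
    have := ltn_trans ltv ltw; rewrite ltnn.
by case: hv hw => -> [] [p1 p2] //; apply: absurd.
Qed.

Lemma component_poly_homog C :
  component_poly C \is (#|edges_in C| - #|C|.-1)%N.-homog.
Proof.
apply: rpred_sum => T hT; have TC : T \subset edges_in C by case/and3P: hT.
rewrite -(spanning_tree_card hT) -(cardsDS TC).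
have -> : #|edges_in C :\: T| = (\sum_(e in edges_in C :\: T) 1)%N.
  by rewrite sum1_card.
elim/big_rec2: _ => [|e d q _ hq]; first exact: dhomog1.
by apply: dhomogM => //; rewrite dhomogX /= mdeg1.
Qed.

Lemma graph_poly_homog : graph_poly \is homog mdeg.
Proof.
rewrite /graph_poly; elim/big_ind: _ => [|p q|C _].
- exact: homog1.
- by move=> /homogP[d hp] /homogP[e hq]; apply: homogE (dhomogM hp hq).
- exact: homogE (component_poly_homog C).
Qed.

Definition graph_hypersurface : qproj #|edge G| := hypersurface graph_poly_homog.

End Graph.

(* Main.v *)
(* Write [X_G] as the complement in projective space of [D(p)], the locus where
   [p := psi_G] does not vanish.  For each edge variable [x], [p = x q + r] with
   [q], [r] free of [x].  On [D(p)], the part where [q = 0] is invariant under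
   translation along [x], hence its class is a multiple of [L]; the part where
   [q <> 0] is isomorphic to [D(x q)] by [x |-> x + r / q].  Hence
   [D(p) = D(x q)] modulo [L]; doing this for all variables replaces [p] by its
   term divisible by every variable.  That term is 0 as soon as [G] has a
   non-looping edge, since then spanning forests are nonempty.  The argument
   only needs [p] to be homogeneous of positive degree, which holds as [G] is
   not a forest. *)
Require Import Defs.
From mathcomp Require Import all_boot.
From mathcomp Require Import all_order all_algebra all_field.
From mathcomp Require Import boolp mpoly.

Set Implicit Arguments.
Unset Strict Implicit.
Unset Printing Implicit Defensive.

Import GRing.Theory.
Local Open Scope ring_scope.

(** * Evaluation of rational polynomials at algebraic points *)

Section Eval.
Variable n : nat.
Implicit Types (x : 'rV[algC]_n) (p : {mpoly rat[n]}).

Lemma evalQD x p q : evalQ x (p + q) = evalQ x p + evalQ x q.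
Proof. exact: rmorphD. Qed.

Lemma evalQ1 x : evalQ x 1 = 1.
Proof. exact: rmorph1. Qed.

Lemma evalQX x i : evalQ x 'X_i = x 0 i.
Proof. by rewrite /evalQ mmapX mmap1U. Qed.

Lemma evalQ0_homog d p : p \is d.+1.-homog -> evalQ 0 p = 0.
Proof.
by move=> hp; rewrite -(scale0r 0) (evalQ_homog _ _ hp) expr0n /= mul0r.
Qed.

End Eval.

(** * Isomorphisms given by homogeneous polynomials *)

Lemma regular_polymap m n (X : qproj m) (Y : qproj n) d
    (h : 'I_n -> {mpoly rat[m]}) :
  (forall i, h i \is d.-homog) ->
  (forall x, on_var X x -> on_var Y (evalQs h x)) ->
  regular_map X Y (evalQs h).
Proof.
move=> hh hXY; split=> // x Xx; exists d, h => //; split.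
  by have /and3P[] := hXY x Xx.
by move=> y _ _; exists 1; rewrite ?oner_eq0 ?scale1r.
Qed.

(** Both isomorphisms needed below are given by one tuple of polynomials on the whole variety, with
    inverses holding only up to a scalar that depends on the point. *)
Lemma kclass_polymap m n (X : qproj m) (Y : qproj n) d e
    (f : 'I_n -> {mpoly rat[m]}) (g : 'I_m -> {mpoly rat[n]}) :
  (forall i, f i \is d.-homog) -> (forall i, g i \is e.-homog) ->
  (forall x, on_var X x -> on_var Y (evalQs f x)) ->
  (forall y, on_var Y y -> on_var X (evalQs g y)) ->
  (forall x, on_var X x -> same_pt x (evalQs g (evalQs f x))) ->
  (forall y, on_var Y y -> same_pt y (evalQs f (evalQs g y))) ->
  kclass X = kclass Y.
Proof.
move=> hf hg fXY gYX gf fg; apply: kclass_iso.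
by exists (evalQs f), (evalQs g);
split=> //; [exact: regular_polymap hf fXY | exact: regular_polymap hg gYX].
Qed.

(** * Cutting a variety along the zero locus of a polynomial *)

Section Cut.
Variables (n : nat) (X : qproj n) (p : {mpoly rat[n]}) (hp : p \is homog mdeg).

Fact nonvanishing_homog :
  homog_data (eqns X, [seq p * q | q <- neqns X]).
Proof.
have /andP[hX hX'] := valP X; apply/andP; split=> //.
apply/allP => _ /mapP[q /(allP hX')/homogP[e hq] ->].
by have /homogP[d hd] := hp; apply: homogE (dhomogM hd hq).
Qed.

Definition nonvanishing : qproj n := Sub (_, _) nonvanishing_homog.

Fact vanishing_homog : homog_data (p :: eqns X, neqns X).
Proof. by have := valP X; rewrite /homog_data /= hp. Qed.

Definition vanishing : qproj n := Sub (_, _) vanishing_homog.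

Lemma on_nonvanishing x :
  on_var nonvanishing x = on_var X x && (evalQ x p != 0).
Proof.
rewrite /on_var /= has_map -!andbA; congr [&& _, _ & _].
apply/hasP/andP => [[q qX]|[/hasP[q qX qx] px]] /=.
  by rewrite evalQM mulf_eq0 negb_or => /andP[px qx]; split=> //; apply/hasP; exists q.
by exists q; rewrite //= evalQM mulf_neq0.
Qed.

Lemma on_vanishing x : on_var vanishing x = on_var X x && (evalQ x p == 0).
Proof. by rewrite /on_var /= andbC -!andbA andbC -!andbA; do !bool_congr. Qed.

Lemma kclass_cut : kclass X = kclass nonvanishing + kclass vanishing.
Proof.
apply: kclass_scissors => [|x].
  by exists [:: p] => [|x]; rewrite /= ?hp // andbT on_vanishing.
by rewrite on_nonvanishing on_vanishing; case: on_var.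
Qed.

End Cut.

(** An empty [X] is closed in itself and is also its own complement there, so the scissors relation
    reads [X] = [X] + [X]. *)
Lemma kclass_empty n (X : qproj n) : (forall x, ~~ on_var X x) -> kclass X = 0.
Proof.
move=> X0; apply: (addrI (kclass X)); rewrite addr0; apply/esym/kclass_scissors.
  by exists [::] => // x; rewrite andbT.
by move=> x; rewrite (negPf (X0 x)).
Qed.

Definition L_multiple (a : KVar) := exists b, a = b * Lclass.

Lemma L_multiple0 : L_multiple 0.
Proof. by exists 0; rewrite mul0r. Qed.

Lemma L_multipleD a b : L_multiple a -> L_multiple b -> L_multiple (a + b).
Proof. by move=> [a' ->] [b' ->]; exists (a' + b'); rewrite mulrDl. Qed.

(** * Varieties invariant under translation along a coordinate *)

Section Cone.
Variables (n : nat) (k : 'I_n).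
Implicit Types (x : 'rV[algC]_n) (X : qproj n).

(* [X] is a cone with the [k]-th coordinate point removed: that point itself
   cannot lie on [X], since it can be translated to 0. *)
Definition coord_cone X :=
  forall x c, on_var X x -> on_var X (x + c *: delta_mx 0 k).


Lemma coord_translate x c i : (x + c *: delta_mx 0 k) 0 i = x 0 i + c *+ (i == k).
Proof. by rewrite !mxE /= mulr_natr. Qed.

(** As x_j vanishes nowhere on [X], the ratio x_k / x_j is a global coordinate along the translation
    lines: x corresponds to the pair of (x_j : x_k) in A^1 and x with its [k]-th coordinate set to
    0. *)
Lemma cone_trivial X j : j != k -> coord_cone X ->
  (forall x, on_var X x -> x 0 j != 0) ->
  kclass X = Lclass * kclass (vanishing X (homogXU k)).
Proof.
move=> jk Xk Xj; rewrite kclass_prod.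
(* The rank-one matrix that represents this pair under the Segre embedding; its entries have degree
   2. *)
pose F : 'M[{mpoly rat[n]}]_(2, n) := \matrix_(a, i)
  ((if a == 0 then 'X_j else 'X_k) * (if i == k then 0 else 'X_i)).
pose f s := mxvec F 0 s.
(* The inverse sends y1^T y2 to the point y1_0 y2 + y1_1 y2_j e_k, whose [k]-th and [j]-th
   coordinates have ratio y1_1 / y1_0. *)
pose g i := if i == k then segre_coord 1 j : {mpoly rat[2 * n]} else segre_coord 0 i.
pose u x : 'rV[algC]_2 := \row_a (if a == 0 then x 0 j else x 0 k).
have uE x a : u x 0 a = if a == 0 then x 0 j else x 0 k by rewrite mxE.
have evf x : evalQs f x = mxvec ((u x)^T *m (x - x 0 k *: delta_mx 0 k)).
  apply/rowP => s; case/mxvec_indexP: s => a i; rewrite mxvecE !mxE big_ord1.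
  rewrite /f mxvecE !mxE evalQM; congr (_ * _); first by case: eqP => _; rewrite evalQX.
  case: eqP => [->|_]; rewrite /= ?mulr1 ?mulr0 ?subrr ?subr0 ?evalQX //.
  exact: rmorph0.
have evg (y1 : 'rV[algC]_2) (y2 : 'rV[algC]_n) : y2 0 k = 0 ->
    evalQs g (mxvec (y1^T *m y2)) = y1 0 0 *: y2 + (y1 0 1 * y2 0 j) *: delta_mx 0 k.
  move=> y2k; apply/rowP => i; rewrite coord_translate !mxE /g.
  case: eqP => [->|_]; rewrite evalQ_coord mxvecK !mxE big_ord1 !mxE ?y2k.
    by rewrite mulr0 add0r.
  by rewrite addr0.
have uaff x : on_var X x -> on_var affine_line (u x).
  move=> Xx; have xj := Xj x Xx; apply/and3P; split=> //=.
    by apply: contraNneq xj => /rowP/(_ 0); rewrite !mxE /= => ->.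
  by rewrite evalQX mxE /= xj.
have proj0 x : (x - x 0 k *: delta_mx 0 k) 0 k = 0.
  by rewrite -scaleNr coord_translate eqxx subrr.
have projj x c : (x + c *: delta_mx 0 k) 0 j = x 0 j.
  by rewrite coord_translate (negPf jk) addr0.
have Xproj x : on_var X x ->
    on_var (vanishing X (homogXU k)) (x - x 0 k *: delta_mx 0 k).
  by move=> Xx; rewrite on_vanishing evalQX proj0 eqxx andbT -scaleNr Xk.
have affP (y1 : 'rV[algC]_2) (y2 : 'rV[algC]_n) :
    on_var affine_line y1 -> on_var (vanishing X (homogXU k)) y2 ->
    [/\ y1 0 0 != 0, y2 0 k = 0, y2 0 j != 0 & on_var X y2].
  move=> /and3P[_ _]; rewrite /= orbF evalQX => y10.
  by rewrite on_vanishing evalQX => /andP[Xy /eqP->]; split=> //; apply: Xj.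
apply: (kclass_polymap (d := 2) (e := 1) (f := f) (g := g)).
- case/mxvec_indexP=> a i; rewrite /f mxvecE mxE; apply: (dhomogM (d := 1) (e := 1)).
    by case: eqP => _; rewrite dhomogX /= mdeg1.
  by case: eqP => _; rewrite ?rpred0 // dhomogX /= mdeg1.
- by move=> i; rewrite /g; case: eqP => _; apply: segre_coord_homog.
- move=> x Xx; rewrite evf; apply/segreP.
  by exists (u x), (x - x 0 k *: delta_mx 0 k); split; auto.
- move=> z /segreP[y1 [y2 [h1 h2 ->]]]; have [y10 y2k _ Xy] := affP _ _ h1 h2.
  by rewrite evg //; apply: Xk; rewrite on_varZ.
- move=> x Xx; exists (x 0 j); first exact: Xj.
  rewrite evf evg // !uE /= -scaleNr projj.
  apply/rowP => i; rewrite coord_translate !mxE /=.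
  by case: eqP => [->|_]; rewrite /= ?mulr1 ?mulr0 ?addr0 // subrr mulr0 add0r mulrC.
- move=> z /segreP[y1 [y2 [h1 h2 ->]]]; have [y10 y2k yj _] := affP _ _ h1 h2.
  exists (y1 0 0 * y2 0 j); first exact: mulf_neq0.
  rewrite evg // evf -!linearZ /=; congr mxvec.
  have -> c : c *: y2 + (y1 0 1 * y2 0 j) *: delta_mx 0 k -
     (c *: y2 + (y1 0 1 * y2 0 j) *: delta_mx 0 k) 0 k *: delta_mx 0 k = c *: y2.
    by rewrite coord_translate eqxx mxE y2k mulr0 add0r addrK.
  have -> : u (y1 0 0 *: y2 + (y1 0 1 * y2 0 j) *: delta_mx 0 k) = y2 0 j *: y1.
    apply/rowP => a; rewrite uE projj coord_translate eqxx !mxE y2k.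
    case: eqP => [->|/eqP a0]; first by rewrite mulrC.
    rewrite mulr0 add0r mulrC; congr (_ * y1 _ _).
    by apply/val_inj; case: a a0 => [[|[]]].
  apply/matrixP => a i; rewrite !mxE !big_ord1 !mxE !mulrA; congr (_ * _).
  by rewrite [y2 0 j * _]mulrC mulrAC.
Qed.

(** Stratify [X] by the first nonzero coordinate other than x_k; [cone_trivial] applies to each
    stratum. *)
Lemma cone_L_multiple X : coord_cone X -> L_multiple (kclass X).
Proof.
(* The list [l] holds the coordinates not yet known to vanish on [X]. The induction splits off the
   points where its head is nonzero. *)
have [l] : exists l : seq 'I_n, forall x, on_var X x ->
    (forall j, j \notin l -> j != k -> x 0 j = 0).
  by exists (enum 'I_n) => x _ j; rewrite mem_enum.
elim: l X => [|j l IH] X hl Xk.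
  rewrite kclass_empty; first exact: L_multiple0.
  (* Only x_k can be nonzero here, so translating by -x_k would put the zero vector on [X]. *)
  move=> x; apply/negP => Xx; have := Xk x (- x 0 k) Xx.
  have -> : x + - x 0 k *: delta_mx 0 k = 0.
    apply/rowP => i; rewrite coord_translate mxE.
    by have [->|ik] := eqVneq i k; rewrite ?subrr // addr0 (hl x Xx).
  by case/and3P; rewrite eqxx.
have [jk|jk] := eqVneq j k.
  apply: IH Xk => x Xx i il ik; apply: hl => //.
  by rewrite inE negb_or il jk ik.
have coordj x c : (x + c *: delta_mx 0 k) 0 j = x 0 j.
  by rewrite coord_translate (negPf jk) addr0.
rewrite (kclass_cut X (homogXU j)); apply: L_multipleD.
  rewrite (@cone_trivial _ j) //.
  - by eexists; rewrite mulrC.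
  - by move=> x c; rewrite !on_nonvanishing !evalQX coordj => /andP[/Xk-> ->].
  - by move=> x; rewrite on_nonvanishing evalQX => /andP[].
apply: IH => [x|x c]; rewrite !on_vanishing !evalQX.
  move=> /andP[Xx /eqP xj] i il ik.
  have [->//|ij] := eqVneq i j.
  by apply: (hl x Xx) => //; rewrite inE negb_or ij.
by rewrite coordj => /andP[/Xk-> ->].
Qed.

End Cone.

(** * Squarefree polynomials and the loci where they do not vanish *)

Section Multilinear.
Variable n : nat.
Implicit Types (A : {set 'I_n}) (c : {set 'I_n} -> rat) (k : 'I_n).

Definition monom_of A : {mpoly rat[n]} := \prod_(i in A) 'X_i.

(** With coefficients indexed by sets of variables, keeping only the terms divisible by a given
    variable is an operation on [c] alone. *)
Definition multilinear c : {mpoly rat[n]} := \sum_A c A *: monom_of A.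

Definition of_degree c d := forall A, c A != 0 -> #|A| = d.

Lemma monom_of_homog A : monom_of A \is #|A|.-homog.
Proof.
rewrite /monom_of; have -> : #|A| = (\sum_(i in A) 1)%N by rewrite sum1_card.
elim/big_rec2: _ => [|i d p _ hp]; first exact: dhomog1.
by apply: dhomogM => //; rewrite dhomogX /= mdeg1.
Qed.

Lemma multilinear_homog c d : of_degree c d -> multilinear c \is d.-homog.
Proof.
move=> hc; apply: rpred_sum => A _.
have [->|/hc<-] := eqVneq (c A) 0; first by rewrite scale0r rpred0.
exact/rpredZ/monom_of_homog.
Qed.

Definition restrict c k A := if k \in A then c A else 0.
Definition slope c k := \sum_(A : {set 'I_n} | k \in A) c A *: monom_of (A :\ k).
Definition intercept c k := \sum_(A : {set 'I_n} | k \notin A) c A *: monom_of A.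

Lemma multilinear_restrict c k : multilinear (restrict c k) = 'X_k * slope c k.
Proof.
rewrite mulr_sumr [LHS](bigID (fun A : {set 'I_n} => k \in A)) /= [X in _ + X]big1 ?addr0.
  by apply: eq_bigr => A kA; rewrite /restrict kA -scalerAr [monom_of A](big_setD1 k).
by move=> A /negPf kA; rewrite /restrict kA scale0r.
Qed.

Lemma multilinearE c k : multilinear c = 'X_k * slope c k + intercept c k.
Proof.
rewrite mulr_sumr [LHS](bigID (fun A : {set 'I_n} => k \in A)) /=; congr (_ + _).
by apply: eq_bigr => A kA; rewrite -scalerAr [monom_of A](big_setD1 k).
Qed.

Lemma of_degree_restrict c d k : of_degree c d -> of_degree (restrict c k) d.
Proof. by move=> hc A; rewrite /restrict; case: ifP => // _; apply: hc. Qed.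

Lemma slope_homog c d k : of_degree c d.+1 -> slope c k \is d.-homog.
Proof.
move=> hc; apply: rpred_sum => A kA.
have [->|/hc] := eqVneq (c A) 0; first by rewrite scale0r rpred0.
by rewrite (cardsD1 k) kA => -[<-]; apply/rpredZ/monom_of_homog.
Qed.

Lemma intercept_homog c d k : of_degree c d -> intercept c k \is d.-homog.
Proof.
move=> hc; apply: rpred_sum => A _.
have [->|/hc<-] := eqVneq (c A) 0; first by rewrite scale0r rpred0.
exact/rpredZ/monom_of_homog.
Qed.

Lemma evalQ_monom_of x A : evalQ x (monom_of A) = \prod_(i in A) x 0 i.
Proof. by rewrite /evalQ rmorph_prod; apply: eq_bigr => i _; apply: evalQX. Qed.

Lemma evalQ_monom_of_translate x a k A : k \notin A ->
  evalQ (x + a *: delta_mx 0 k) (monom_of A) = evalQ x (monom_of A).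
Proof.
move=> kA; rewrite !evalQ_monom_of; apply: eq_bigr => i iA.
by rewrite coord_translate; case: eqP iA kA => [-> ->|]; rewrite ?addr0.
Qed.

Lemma evalQ_slope_translate x a c k :
  evalQ (x + a *: delta_mx 0 k) (slope c k) = evalQ x (slope c k).
Proof.
rewrite /evalQ !raddf_sum; apply: eq_bigr => A _ /=; rewrite !mmapZ /=.
by congr (_ * _); apply: evalQ_monom_of_translate; rewrite !inE eqxx.
Qed.

Lemma evalQ_intercept_translate x a c k :
  evalQ (x + a *: delta_mx 0 k) (intercept c k) = evalQ x (intercept c k).
Proof.
rewrite /evalQ !raddf_sum; apply: eq_bigr => A kA /=; rewrite !mmapZ /=.
by congr (_ * _); apply: evalQ_monom_of_translate.
Qed.

Lemma evalQ_multilinear x c k :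
  evalQ x (multilinear c) = x 0 k * evalQ x (slope c k) + evalQ x (intercept c k).
Proof. by rewrite (multilinearE c k) evalQD evalQM evalQX. Qed.

(** [P] is the whole projective space; [proj_space] has a successor number of coordinates, while [n]
    is arbitrary here. *)
Variables (P : qproj n).
Hypothesis P_full : forall x, on_var P x = (x != 0).

(* Where the slope vanishes, [multilinear c] does not depend on the [k]-th
   coordinate.  Elsewhere, completing [x_k] to [x_k + intercept / slope] is an
   automorphism that carries it to ['X_k * slope]. *)
Lemma kclass_restrict c d k (hc : of_degree c d.+1)
    (hp : multilinear c \is homog mdeg)
    (hp' : multilinear (restrict c k) \is homog mdeg) :
  L_multiple (kclass (nonvanishing P hp) - kclass (nonvanishing P hp')).
Proof.
set q := slope c k; set r := intercept c k.
have hq : q \is d.-homog := slope_homog k hc.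
have hr : r \is d.+1.-homog := intercept_homog k hc.
have qT x a : evalQ (x + a *: delta_mx 0 k) q = evalQ x q.
  exact: evalQ_slope_translate.
have rT x a : evalQ (x + a *: delta_mx 0 k) r = evalQ x r.
  exact: evalQ_intercept_translate.
have pE x : evalQ x (multilinear c) = x 0 k * evalQ x q + evalQ x r.
  exact: evalQ_multilinear.
have p'E x : evalQ x (multilinear (restrict c k)) = x 0 k * evalQ x q.
  by rewrite multilinear_restrict evalQM evalQX.
(* Positive degree matters here: the polynomial vanishes at 0, so translated or mapped vectors at
   which it is nonzero are projective points. *)
have nz x : evalQ x (multilinear c) != 0 -> x != 0.
  by apply: contraNneq => ->; rewrite (evalQ0_homog (multilinear_homog hc)).
have nz' x : evalQ x (multilinear (restrict c k)) != 0 -> x != 0.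
  apply: contraNneq => ->.
  by rewrite (evalQ0_homog (multilinear_homog (of_degree_restrict (k := k) hc))).
rewrite (kclass_cut (nonvanishing P hp) (homogE hq)) addrAC.
set U := nonvanishing (nonvanishing P hp) _.
have -> : kclass U = kclass (nonvanishing P hp'); last first.
  rewrite subrr add0r; apply: (@cone_L_multiple _ k) => x a.
  rewrite !on_vanishing !on_nonvanishing !P_full qT.
  case/andP=> /andP[x0 px] qx; rewrite qx andbT.
  have px' : evalQ (x + a *: delta_mx 0 k) (multilinear c) != 0.
    by move: px; rewrite !pE qT rT (eqP qx) !mulr0.
  by rewrite nz.
(* Translation of x_k by r / q for [b = false] and by -r / q for [b = true], with the denominator
   cleared. *)
pose f b i : {mpoly rat[n]} := q * 'X_i + (-1) ^+ b *: (if i == k then r else 0).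
have hf b i : f b i \is d.+1.-homog.
  apply: rpredD; first by rewrite -addn1; apply: dhomogM; rewrite // dhomogX /= mdeg1.
  by apply: rpredZ; case: eqP; rewrite ?rpred0.
have fE b x : evalQs (f b) x = evalQ x q *: x + ((-1) ^+ b * evalQ x r) *: delta_mx 0 k.
  apply/rowP => i; rewrite coord_translate !mxE evalQD evalQM evalQX; congr (_ + _).
  rewrite /evalQ mmapZ rmorphXn rmorphN1.
  by case: eqP => _; rewrite ?rmorph0 ?mulr0.
(* Since q and r do not involve x_k, [f b] affects them only through the scaling of x by q(x). *)
have qf b x : evalQ (evalQs (f b) x) q = evalQ x q ^+ d.+1.
  by rewrite fE qT (evalQ_homog _ _ hq) exprSr.
have rf b x : evalQ (evalQs (f b) x) r = evalQ x q ^+ d.+1 * evalQ x r.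
  by rewrite fE rT (evalQ_homog _ _ hr).
have fk b x : evalQs (f b) x 0 k = x 0 k * evalQ x q + (-1) ^+ b * evalQ x r.
  by rewrite fE coord_translate eqxx mxE mulrC.
(* The two translations cancel; the first map contributes a factor q and the second a factor
   q^(d+1). *)
have ff b x : evalQ x q != 0 -> same_pt x (evalQs (f (~~ b)) (evalQs (f b) x)).
  move=> qx; exists (evalQ x q ^+ d.+2); first by rewrite expf_eq0 (negPf qx) andbF.
  rewrite fE qf rf fE scalerDr !scalerA -exprSr -addrA -scalerDl.
  rewrite -[RHS]addr0; congr (_ + _); apply/eqP; rewrite scaler_eq0; apply/orP; left.
  by case: b; rewrite /= expr0 expr1 mul1r mulN1r ?mulrN ?subrr ?addNr.
apply: (kclass_polymap (hf false) (hf true)).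
- move=> x; rewrite !on_nonvanishing !P_full => /andP[/andP[x0 px] qx].
  have px' : evalQ (evalQs (f false) x) (multilinear (restrict c k)) != 0.
    rewrite p'E fk qf expr0 mul1r -pE mulf_neq0 //.
    by rewrite expf_eq0 (negPf qx) andbF.
  by rewrite px' nz'.
- move=> x; rewrite !on_nonvanishing !P_full p'E mulf_eq0 negb_or.
  move=> /and3P[x0 xk qx].
  have px' : evalQ (evalQs (f true) x) (multilinear c) != 0.
    rewrite pE fk qf rf expr1 mulN1r mulrBl [evalQ x r * _]mulrC subrK.
    by rewrite !mulf_neq0 // expf_eq0 (negPf qx) andbF.
  by rewrite px' nz //= qf expf_eq0 (negPf qx) andbF.
- by move=> x; rewrite on_nonvanishing => /andP[_ /(ff false)].
- move=> x; rewrite on_nonvanishing p'E mulf_eq0 negb_or.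
  by case/and3P=> _ _ /(ff true).
Qed.

Lemma kclass_multilinear c d (hc : of_degree c d.+1)
    (hp : multilinear c \is homog mdeg) :
  c setT = 0 -> L_multiple (kclass (nonvanishing P hp)).
Proof.
(* Induction invariant: [c] vanishes on every set containing all variables still to be treated. For
   the full list this is [c setT = 0]; for the empty list it says that the polynomial is 0. *)
move=> c1; have : forall A, {subset enum 'I_n <= A} -> c A = 0.
  move=> A sA; suff -> : A = setT by [].
  by apply/setP => i; rewrite inE sA ?mem_enum.
elim: (enum _) c hc hp {c1} => [|k l IH] c hc hp cA.
  rewrite kclass_empty; first exact: L_multiple0.
  move=> x; rewrite on_nonvanishing negb_and negbK.
  have -> : multilinear c = 0.
    by rewrite /multilinear big1 // => A _; rewrite cA ?scale0r.
  by rewrite /evalQ rmorph0 eqxx orbT.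
have hc' := of_degree_restrict (k := k) hc; have hp' := homogE (multilinear_homog hc').
rewrite -[kclass _](subrK (kclass (nonvanishing P hp'))).
apply: L_multipleD; first exact: kclass_restrict hc _ _.
apply: IH => // A lA; rewrite /restrict; case: ifP => // kA; apply: cA => i.
by rewrite inE => /orP[/eqP->|/lA].
Qed.

End Multilinear.

(** * Hypersurfaces with a squarefree equation *)

Lemma hypersurface_L_rational n (p : {mpoly rat[n]}) (hp : p \is homog mdeg)
    (c : {set 'I_n} -> rat) d :
  (0 < n)%N -> p = multilinear c -> of_degree c d.+1 -> c setT = 0 ->
  L_rational (hypersurface hp).
Proof.
case: n p hp c => // n p hp c _ pE; move: hp; rewrite {p}pE => hp hc c1; exists n.
have [|b bE] := kclass_multilinear (P := proj_space n) _ hc hp c1.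
  by move=> x; rewrite /on_var /= evalQ1 oner_eq0 orbF andbT.
(* The hypersurface is compared with its ambient space, from which it differs by the nonvanishing
   locus; hence the sign. *)
exists (- b); rewrite mulNr -bE (kclass_cut (proj_space n) hp).
have -> : vanishing (proj_space n) hp = hypersurface hp by apply: val_inj.
by rewrite opprD addrCA subrr addr0.
Qed.

(** Grouping the indices by the fibres of [phi] turns coefficients into counts, so a coefficient is
    nonzero only at a value of [phi] on [Q]. *)
Lemma sum_monom_of n (I : finType) (Q : pred I) (phi : I -> {set 'I_n}) :
  \sum_(f | Q f) monom_of (phi f) =
  multilinear (fun A => \sum_(f | Q f && (phi f == A)) 1).
Proof.
rewrite (partition_big phi xpredT) //; apply: eq_bigr => A _.
rewrite scaler_suml; apply: eq_bigr => f /andP[_ /eqP->].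
by rewrite scale1r.
Qed.

(** * The graph polynomial as a sum over spanning forests *)

Section GraphPolynomial.
Variable G : mgraph.
Implicit Types (e : edge G) (T : {set edge G}) (C : {set vert G}).

Definition component_of (v : vert G) : {set vert G} := pblock (components G) v.

Lemma connect_equivalence :
  {in [set: vert G] & &, equivalence_rel (connect (adj [set: edge G]))}.
Proof.
move=> u v w _ _ _; split; first exact: connect0.
by move=> uv; apply: same_connect uv _; apply: connect_adjC.
Qed.

Lemma components_partition : partition (components G) [set: vert G].
Proof. exact: equivalence_partitionP connect_equivalence. Qed.

Lemma component_of_in v : component_of v \in components G.
Proof. by apply: pblock_mem; rewrite (cover_partition components_partition). Qed.

Lemma mem_component_of v : v \in component_of v.
Proof. by rewrite mem_pblock (cover_partition components_partition). Qed.

Lemma component_ofE C v : C \in components G -> (v \in C) = (component_of v == C).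
Proof.
move=> hC; apply/idP/eqP => [vC|<-]; last exact: mem_component_of.
by apply: def_pblock vC => //; case/and3P: components_partition.
Qed.

Lemma component_of_ends e : component_of (ends e).2 = component_of (ends e).1.
Proof.
have [_ tI _] := and3P components_partition; apply/eqP.
rewrite eq_pblock ?(cover_partition components_partition) //.
rewrite (pblock_equivalence_partition connect_equivalence) ?inE //.
apply: connect1; apply/existsP; exists e.
by rewrite inE -surjective_pairing eqxx orbT.
Qed.

Definition component_of_edge e := component_of (ends e).1.

Lemma edges_inE C e : C \in components G ->
  (e \in edges_in C) = (component_of_edge e == C).
Proof.
by move=> hC; rewrite inE !component_ofE // component_of_ends andbb.
Qed.

(** A spanning forest, given by one tree per component. The default [set0] off the components makes
    [f] unique and is the form in which a product of sums expands. *)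
Definition tree_choice (f : {ffun {set vert G} -> {set edge G}}) :=
  f \in pfamily set0 (mem (components G)) (fun C => [pred T | spanning_tree C T]).

(** For a tree choice this is the complement of the forest: an edge can lie only in the tree of its
    own component. *)
Definition cotree (f : {ffun {set vert G} -> {set edge G}}) :=
  [set e | e \notin f (component_of_edge e)].

Lemma tree_choiceP f C : tree_choice f -> C \in components G ->
  spanning_tree C (f C).
Proof. by move=> /pfamilyP[_ hf] /hf. Qed.

(** The edges are sorted by component. A general law serves both the monomials (product) and their
    degrees (sum). *)
Lemma big_cotree (R : Type) (idx : R) (op : Monoid.com_law idx) f (F : edge G -> R) :
  \big[op/idx]_(e in cotree f) F e =
  \big[op/idx]_(C in components G) \big[op/idx]_(e in edges_in C :\: f C) F e.
Proof.
rewrite (partition_big component_of_edge (mem (components G))); last first.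
  by move=> e _; apply: component_of_in.
apply: eq_bigr => C hC; apply: eq_bigl => e.
rewrite in_setD edges_inE // inE.
by case: eqP => [->|]; rewrite ?andbT ?andbF.
Qed.

(** All spanning trees of a component have equally many edges, so this value does not depend on [f];
    it is the common degree of the monomials. *)
Lemma card_cotree f : tree_choice f ->
  #|cotree f| = (\sum_(C in components G) (#|edges_in C| - #|C|.-1))%N.
Proof.
move=> hf; rewrite -sum1_card big_cotree; apply: eq_bigr => C hC.
have hT := tree_choiceP hf hC; have /and3P[TC _ _] := hT.
by rewrite sum1_card cardsDS // (spanning_tree_card hT).
Qed.

(** The product over components is distributed over the sums over spanning trees. *)
Lemma graph_polyE :
  graph_poly G = \sum_(f | tree_choice f) monom_of (@enum_rank (edge G) @: cotree f).
Proof.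
rewrite /graph_poly /component_poly (big_distr_big_dep set0) /=.
apply: eq_bigr => f _; rewrite -big_cotree /monom_of big_imset //=.
by move=> e e' _ _; apply: enum_rank_inj.
Qed.

(** The tree of the component of [e] joins the two distinct ends of [e], so it has an edge [e'],
    possibly other than [e], and [e'] is missing from the cotree. *)
Lemma cotree_proper f : (exists e, ~~ looping_edge e) -> tree_choice f ->
  cotree f != setT.
Proof.
move=> [e le] hf; set C := component_of_edge e.
have hC : C \in components G := component_of_in _.
have hT := tree_choiceP hf hC; have /and3P[TC conn _] := hT.
have /connectP[[|v p] /=] : connect (adj (f C)) (ends e).1 (ends e).2.
  have := edges_inE e hC; rewrite eqxx inE => /andP[e1 e2].
  by move/forall_inP: conn => /(_ _ e1)/forall_inP/(_ _ e2).
  by move=> _ /esym/eqP e12; rewrite /looping_edge e12 in le.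
case/andP=> /existsP[e' /andP[e'T _]] _ _.
apply/eqP => /setP/(_ e'); rewrite !inE.
have /eqP-> : component_of_edge e' == C by rewrite -edges_inE // (subsetP TC).
by rewrite e'T.
Qed.

(** With an empty cotree every edge lies in the tree of its component. A cycle stays within one
    component, so it would be a cycle in a tree. *)
Lemma cotree_nonempty f : ~ forest G -> tree_choice f -> cotree f != set0.
Proof.
move=> nf hf; apply/eqP => f0; apply: nf => -[|d c]; first by [].
apply/negP => hc; have /and5P[_ _ cyc ue us] := hc.
set C := component_of_edge d.1.
have src d' : component_of (dsrc d') = component_of_edge d'.1.
  by rewrite /dsrc; case: (d'.2); rewrite ?component_of_ends.
have tgt d' : component_of (dtgt d') = component_of_edge d'.1.
  by rewrite /dtgt; case: (d'.2); rewrite ?component_of_ends.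
(* Consecutive darts share a vertex, so the component is constant along the cycle. *)
have inC : all (fun d' => component_of_edge d'.1 == C) (d :: c).
  rewrite /= eqxx; move: cyc; rewrite /= rcons_path => /andP[pc _].
  rewrite /C; elim: c d pc {hc ue us C} => //= d' c IH d /andP[/eqP dd' pc].
  have <- : component_of_edge d'.1 = component_of_edge d.1.
    by rewrite -src -dd' tgt.
  by rewrite eqxx IH.
have hC : C \in components G := component_of_in _.
have /and3P[_ _ /asboolP/(_ (d :: c))/negP] := tree_choiceP hf hC; apply.
apply/and5P; split=> //; apply: sub_all inC => d' /eqP d'C.
have /setP/(_ d'.1) := f0; rewrite !inE d'C.
by move/negbFE.
Qed.

End GraphPolynomial.

(** * Application to graph hypersurfaces *)

Theorem corollary3p3 (G : mgraph) (not_forest : ~ forest G)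
    (has_nonlooping : exists e : edge G, ~~ looping_edge e) :
  L_rational (graph_hypersurface G).
Proof.
(* The coefficient of [A] counts the spanning forests with complement [A]. *)
set c : {set 'I_#|edge G|} -> rat := fun A =>
  \sum_(f | tree_choice f && ([set enum_rank e | e in cotree f] == A)) 1.
have cP A : c A != 0 ->
    exists2 f, @tree_choice G f & [set enum_rank e | e in cotree f] = A.
  move=> cA; have [f /andP[hf /eqP fA]|no] :=
    pickP [pred f | @tree_choice G f && ([set enum_rank e | e in cotree f] == A)].
    by exists f.
  by rewrite /c big_pred0 ?eqxx in cA.
pose d := (\sum_(C in components G) (#|edges_in C| - #|C|.-1))%N.
(* The degree is required as a successor; [d] is positive because cotrees are nonempty when the
   graph is not a forest. *)
apply: (@hypersurface_L_rational _ _ _ c d.-1).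
- by case: has_nonlooping => e _; apply/card_gt0P; exists e.
- by rewrite graph_polyE sum_monom_of.
- move=> A /cP[f hf <-]; rewrite (card_imset _ (@enum_rank_inj _)).
  rewrite card_cotree // prednK // -[X in (0 < X)%N](card_cotree hf).
  by rewrite card_gt0 cotree_nonempty.
- have [//|/cP[f hf fT]] := eqVneq (c setT) 0.
  suff /eqP : cotree f = setT by rewrite (negPf (cotree_proper has_nonlooping hf)).
  by apply/setP => e; rewrite -(mem_imset _ _ enum_rank_inj) fT !inE.
Qed.
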